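(* Let $r\ge1$, let $k_1,\ldots,k_r$ be positive integers, and put $k=k_1+\cdots+k_r$. Then, in $\mathcal{A}$, $$\sum_{\sigma\in\Sigma_{r}}\left(r+1-2\sigma^{-1}(r)\right)\zeta_{\mathcal{A}}(k_{\sigma(1)},\dots,k_{\sigma(r)})=(-1)^{r}\,2\sum_{\tau\in\Sigma_{r-1}}C(k_{\tau(1)},\ldots,k_{\tau(r-1)},k_{r})\cdot Z(k).$$
   Context: Let $\mathcal{A}=\left(\prod_{p}\mathbb{Z}/p\mathbb{Z}\right)/\left(\bigoplus_{p}\mathbb{Z}/p\mathbb{Z}\right)$, where $p$ runs over all prime numbers; it is a $\mathbb{Q}$-algebra. An element of $\mathcal{A}$ is represented by a family $(a_{(p)})_p$ with $a_{(p)}\in\mathbb{Z}/p\mathbb{Z}$ (finitely many components may be left undefined), and two families represent the same element iff they agree for all but finitely many $p$. For positive integers $k_1,\ldots,k_r$, define $\zeta_{\mathcal{A}}(k_1,\ldots,k_r)\in\mathcal{A}$ by $$\zeta_{\mathcal{A}}(k_1,\ldots,k_r)_{(p)}=\sum_{0<m_1<\cdots<m_r<p}\frac{1}{m_1^{k_1}\cdots m_r^{k_r}}\bmod p.$$ For an integer $k\ge2$, define $Z(k)\in\mathcal{A}$ by $Z(k)_{(p)}=\frac{B_{p-k}}{k}\bmod p$, where $B_n$ is the $n$th Bernoulli number. For positive integers $k_1,\ldots,k_r$ with sum $k$, put $$C(k_1,\ldots,k_r)=\sum_{j=1}^{r-1}(-1)^{k_1+\cdots+k_j}\binom{k}{k_1+\cdots+k_j}\in\mathbb{Z}.$$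 $\Sigma_n$ denotes the group of permutations of $\{1,\ldots,n\}$ ($\Sigma_0$ is trivial). When $r=1$, $C(k_1)=0$ is an empty sum, and the right-hand side of the identity is understood to be $0$ (including the case $k=1$, where $Z(1)$ is not defined). *)

(* Defs.v *)
From HB Require Import structures.
From mathcomp Require Import all_boot all_order all_algebra all_fingroup.
From mathcomp Require Import boolp classical_sets cardinality.

Set Implicit Arguments.
Unset Strict Implicit.
Unset Printing Implicit Defensive.

Import GRing.Theory.
Local Open Scope ring_scope.
Local Open Scope quotient_scope.

Definition primes_t := {p : nat | prime p}.

Definition prodF := forall p : primes_t, 'F_(val p).

HB.instance Definition _ := Choice.copy prodF (forall p : primes_t, 'F_(val p)).

Section ProductRing.

Implicit Types a b c : prodF.

Definition prodF_zero : prodF := fun=> 0.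
Definition prodF_one : prodF := fun=> 1.
Definition prodF_opp a : prodF := fun p => - a p.
Definition prodF_add a b : prodF := fun p => a p + b p.
Definition prodF_mul a b : prodF := fun p => a p * b p.

Fact prodF_addA : associative prodF_add.
Proof. by move=> a b c; apply: functional_extensionality_dep => p; exact: addrA. Qed.

Fact prodF_addC : commutative prodF_add.
Proof. by move=> a b; apply: functional_extensionality_dep => p; exact: addrC. Qed.

Fact prodF_add0 : left_id prodF_zero prodF_add.
Proof. by move=> a; apply: functional_extensionality_dep => p; exact: add0r. Qed.

Fact prodF_addN : left_inverse prodF_zero prodF_opp prodF_add.
Proof. by move=> a; apply: functional_extensionality_dep => p; exact: addNr. Qed.

HB.instance Definition _ :=
  GRing.isZmodule.Build prodF prodF_addA prodF_addC prodF_add0 prodF_addN.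

Fact prodF_mulA : associative prodF_mul.
Proof. by move=> a b c; apply: functional_extensionality_dep => p; exact: mulrA. Qed.

Fact prodF_mulC : commutative prodF_mul.
Proof. by move=> a b; apply: functional_extensionality_dep => p; exact: mulrC. Qed.

Fact prodF_mul1 : left_id prodF_one prodF_mul.
Proof. by move=> a; apply: functional_extensionality_dep => p; exact: mul1r. Qed.

Fact prodF_mulDl : left_distributive prodF_mul +%R.
Proof. by move=> a b c; apply: functional_extensionality_dep => p; exact: mulrDl. Qed.

Fact prodF_1_neq0 : prodF_one != 0.
Proof.
apply/eqP => /(congr1 (fun a : prodF => a (exist _ 2%N (erefl true)))).
by move/eqP; rewrite oner_eq0.
Qed.

HB.instance Definition _ := GRing.Zmodule_isComNzRing.Build prodF
  prodF_mulA prodF_mulC prodF_mul1 prodF_mulDl prodF_1_neq0.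

End ProductRing.

(* The direct sum, as an ideal of the product. *)
Definition sumF : {pred prodF} :=
  fun a => `[< finite_set [set p : primes_t | a p != 0] >].

Lemma finite_primesP (P : set primes_t) :
  finite_set P <-> exists N : nat, forall p, P p -> (val p <= N)%N.
Proof.
split=> [/finite_seqP[s ->]|[N PN]].
  exists (\max_(p <- s) val p)%N => p /= ps.
  by rewrite (big_rem p) //= leq_maxl.
apply: (@sub_finite_set _ _ (val @^-1` `I_N.+1)%classic).
  by move=> p /PN; rewrite /= ltnS.
by apply: finite_preimage (finite_II _) => p q _ _; exact: val_inj.
Qed.

Lemma sumFP a :
  reflect (exists N : nat, forall p : primes_t, (N < val p)%N -> a p = 0)
          (a \in sumF).
Proof.
apply: (equivP (asboolP _)); rewrite finite_primesP.
split=> -[N aN]; exists N => p; have := aN p; rewrite /= ltnNge.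
  by move=> ap; apply: contraNeq.
by move=> ap; apply: contraNT => /ap ->.
Qed.

Fact sumF_idealr_closed : idealr_closed sumF.
Proof.
split=> [||c a b /sumFP[N aN] /sumFP[M bM]].
- by apply/sumFP; exists 0%N.
- apply/sumFP => -[N h]; have [p Np pp] := prime_above N.
  by have /eqP := h (exist _ p pp) Np; rewrite oner_eq0.
- apply/sumFP; exists (maxn N M) => p; rewrite gtn_max => /andP[Np Mp].
  have -> : (c * a + b) p = c p * a p + b p by [].
  by rewrite aN // bM // mulr0 addr0.
Qed.

HB.instance Definition _ := isIdealr.Build prodF sumF sumF_idealr_closed.

Definition A : comNzRingType := {ideal_quot sumF}.

Definition fam (a : prodF) : A := \pi a.

Lemma famP a b :
  fam a = fam b <->
  exists N : nat, forall p : primes_t, (N < val p)%N -> a p = b p.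
Proof.
have -> : (fam a = fam b) <-> (a - b \in sumF).
  by rewrite Quotient.idealrBE; split=> /eqP.
split=> [/sumFP[N h]|[N h]].
  by exists N => p /h /eqP; rewrite subr_eq0 => /eqP.
by apply/sumFP; exists N => p /h abp; apply/eqP; rewrite subr_eq0 abp.
Qed.

Definition zetaA (r : nat) (k : 'I_r -> nat) : A :=
  fam (fun p : primes_t =>
    \sum_(m : {ffun 'I_r -> 'I_(val p)} |
            [forall i : 'I_r, (0 < m i)%N] &&
            [forall i : 'I_r, forall j : 'I_r, (i < j)%N ==> (m i < m j)%N])
       (\prod_(i < r) (m i)%:R ^+ k i)^-1).

Fixpoint bernoulli_seq (n : nat) : seq rat :=
  if n isn't n'.+1 then [:: 1] else
  let s := bernoulli_seq n' in
  rcons s (- (\sum_(j < n) 'C(n.+1, j)%:R * s`_j) / n.+1%:R).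

Definition bernoulli (n : nat) : rat := (bernoulli_seq n)`_n.

Lemma size_bernoulli_seq n : size (bernoulli_seq n) = n.+1.
Proof. by elim: n => //= n IHn; rewrite size_rcons IHn. Qed.

Lemma nth_bernoulli_seq n j :
  (j <= n)%N -> (bernoulli_seq n)`_j = bernoulli j.
Proof.
elim: n => [|n IHn]; first by rewrite leqn0 => /eqP ->.
rewrite leq_eqVlt => /predU1P[-> //|]; rewrite ltnS => jn.
by rewrite /= nth_rcons size_bernoulli_seq ltnS jn IHn.
Qed.

Lemma bernoulli_rec n :
  \sum_(j < n.+1) 'C(n.+1, j)%:R * bernoulli j = (n == 0%N)%:R.
Proof.
case: n => [|n]; first by rewrite big_ord1 bin0 mul1r.
rewrite big_ord_recr /= {2}/bernoulli /= nth_rcons size_bernoulli_seq ltnn eqxx.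
rewrite binSn mulrC divfK ?Num.Theory.pnatr_eq0 //.
apply/eqP; rewrite subr_eq0; apply/eqP; apply: eq_bigr => j _.
by rewrite nth_bernoulli_seq // -ltnS.
Qed.

(* ratr sends x to numq x / denq x, which is the reduction of x mod p when p
   does not divide denq x.  For k >= 2 and p > k this applies to B_(p-k) / k,
   since p - 1 does not divide p - k (von Staudt-Clausen) and p does not
   divide k.  The junk components at p <= k do not affect the class, and
   neither does the convention for the sign of B_1. *)
Definition Z (k : nat) : A :=
  fam (fun p : primes_t => ratr (bernoulli (val p - k) / k%:R)).

(* The indices are 0-based: the j-th partial sum adds the entries 0, ..., j-1. *)
Definition C (r : nat) (k : 'I_r -> nat) : int :=
  \sum_(1 <= j < r)
    (-1) ^+ (\sum_(i < r | (i < j)%N) k i)%N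
    * ('C((\sum_(i < r) k i)%N, (\sum_(i < r | (i < j)%N) k i)%N))%:Z.

(* Main.v *)
Require Import Defs.
From HB Require Import structures.
From mathcomp Require Import all_boot all_order all_algebra all_fingroup.
From mathcomp Require Import ring zify.

(** Fix a prime [p] larger than [k + 1], where [k] is the sum of the exponents,
    and compare the components at [p].

    A permutation together with an increasing sequence is the same thing as an
    injective family [m_1, ..., m_r] of residues, and the position of [r] in
    the ordering is the rank of [m_r] among the [m_i].  Hence the coefficient
    [r + 1 - 2 s^-1(r)] is the number of [m_i] above [m_r] minus the number of
    [m_i] below it, and the left-hand side becomes
      [sum_(i <> r) sum_(m injective) sgn(m_i - m_r) prod_j m_j^(-k_j)]
    ([sum_perm_increasing], [sum_sgn_rank]).

    Fix the values [u <> v] of [m_i] and [m_r].  All power sums of exponent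
    strictly between [0] and [p - 1] vanish modulo [p], so the polynomial
    [prod_w (1 + w t)] over the nonzero residues acts as [1], and deleting the
    factors of [u] and [v] leaves [1 / ((1 + u t) (1 + v t))].  In polarised
    form, the sum over injective families on an index set [J] avoiding [u] and
    [v] is
      [(-1)^|J| sum_(A <= J) |A|! |J - A|! u^(-k_A) v^(-k_(J - A))]
    ([placement_sum_avoid2]).  Summing over [u], [v] and [i] expresses the
    left-hand side as a combination, with weights [|A|! (r - 1 - |A|)!], of the
    signed double sums [sum_(u, v) sgn(u - v) u^(-a) v^(-b)] for [a = k_A] and
    [b = k - a] ([sum_injective_pairs]).

    Because power sums vanish, such a signed double sum is twice a double zeta
    value, and Faulhaber's formula evaluates it as
    [2 (-1)^a binom(k, a) B_(p-k) / k] ([sgn_double_sum_pchar]).  This uses the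
    Bernoulli numbers [B_n] with [n < p - 1] modulo [p]; they are [p]-integral
    because their recursion divides only by integers smaller than [p].

    On the other side, [|A|! (r - 1 - |A|)!] permutations of the first
    [r - 1] indices have [A] as the set of their first [|A|] values, so that
    the sum of the [C]'s has the same weights ([sum_C_subsets]). *)

Set Implicit Arguments.
Unset Strict Implicit.
Unset Printing Implicit Defensive.
Import GRing.Theory Num.Theory.
Local Open Scope ring_scope.

(** * Reduction of rational numbers to a field *)

(** The fraction [n / d] need not be in lowest terms, which makes sums and
    products immediate; [ratr] works with lowest terms and is only additive and
    multiplicative on fractions whose denominators survive in [F]. *)
Definition rat_reduces (F : fieldType) (x : rat) (a : F) : Prop :=
  exists n d : int,
    [/\ d%:~R != 0 :> F, x = n%:~R / d%:~R & a = n%:~R / d%:~R].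

Lemma rat_reduces_ratr (F : fieldType) (x : rat) (a : F) :
  rat_reduces x a -> ratr x = a.
Proof.
case=> n [d [d0 xE ->]].
have dz : d%:~R != 0 :> rat by rewrite intr_eq0; apply: contraNneq d0 => ->.
have E : numq x * d = n * denq x.
  apply/eqP; rewrite -(eqr_int rat) !rmorphM /= -eqr_div ?intr_eq0 ?denq_neq0 //.
    by rewrite divq_num_den xE.
  by rewrite -(intr_eq0 rat).
have cop : coprimez (numq x) (denq x) by exact: coprime_num_den.
have /dvdzP[g dE] : (denq x %| d)%Z.
  by rewrite -(Gauss_dvdzr (n := numq x)) 1?coprimez_sym // E dvdz_mull.
move: d0; rewrite /ratr.
have nE : n = g * numq x.
  apply: (mulIf (denq_neq0 x)); rewrite -E dE; ring.
rewrite {xE dz E} dE nE !rmorphM /= mulf_eq0 negb_or => /andP[g0 q0].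
by field; apply/andP.
Qed.

Section Reduction.
Variable F : fieldType.
Implicit Types (x y : rat) (a b : F).

Lemma rat_reduces_int (m : int) : rat_reduces m%:~R (m%:~R : F).
Proof. by exists m, 1; rewrite !divr1 oner_neq0. Qed.

Lemma rat_reducesD x y a b :
  rat_reduces x a -> rat_reduces y b -> rat_reduces (x + y) (a + b).
Proof.
have nz (d : int) : d%:~R != 0 :> F -> d%:~R != 0 :> rat.
  by rewrite intr_eq0; apply: contraNneq => ->.
case=> n [d [d0 -> ->]] [m [e [e0 -> ->]]].
exists (n * e + m * d), (d * e); rewrite !(rmorphM, rmorphD) /= mulf_neq0 //.
by split=> //; field; rewrite ?nz ?d0 ?e0.
Qed.

Lemma rat_reducesM x y a b :
  rat_reduces x a -> rat_reduces y b -> rat_reduces (x * y) (a * b).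
Proof.
have nz (d : int) : d%:~R != 0 :> F -> d%:~R != 0 :> rat.
  by rewrite intr_eq0; apply: contraNneq => ->.
case=> n [d [d0 -> ->]] [m [e [e0 -> ->]]].
exists (n * m), (d * e); rewrite !(rmorphM, rmorphD) /= mulf_neq0 //.
by split=> //; field; rewrite ?nz ?d0 ?e0.
Qed.

Lemma rat_reducesV (n : nat) :
  n%:R != 0 :> F -> rat_reduces n%:R^-1 (n%:R^-1 : F).
Proof. by move=> n0; exists 1, n%:Z; rewrite !mul1r. Qed.

Lemma rat_reduces_sum (I : Type) (r : seq I) (P : pred I)
    (f : I -> rat) (g : I -> F) :
  (forall i, P i -> rat_reduces (f i) (g i)) ->
  rat_reduces (\sum_(i <- r | P i) f i) (\sum_(i <- r | P i) g i).
Proof.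
move=> fg; elim/big_ind2: _ => [|x a y b xa yb|//]; last exact: rat_reducesD.
exact: rat_reduces_int 0.
Qed.

End Reduction.

(** * Faulhaber's formula and power sums in characteristic p *)

Lemma bin_mul_bin N i j : (i + j <= N)%N ->
  ('C(N, j) * 'C(N - j, i) = 'C(N, i) * 'C(N - i, j))%N.
Proof.
move=> ijN; have pos : (0 < i`! * j`! * (N - i - j)`!)%N.
  by rewrite !muln_gt0 !fact_gt0.
apply/eqP; rewrite -(eqn_pmul2r pos); apply/eqP.
have Ni := @bin_fact N i ltac:(lia); have Nj := @bin_fact N j ltac:(lia).
have Nij := @bin_fact (N - i) j ltac:(lia).
have := @bin_fact (N - j) i ltac:(lia); rewrite subnAC => Nji.
transitivity ('C(N, j) * (j`! * ('C(N - j, i) * (i`! * (N - i - j)`!))))%N; first ring.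
rewrite Nji Nj -Ni -Nij; ring.
Qed.

(** Both sides vanish at [M = 0].  Expanding [(M + 1)^(q + 1 - j)] and
    regrouping by powers of [M], the increment of the right-hand side has, as
    coefficient of [M^i], the recursion for [b] at [q - i] up to a factor; only
    [i = q] survives.  The recursion is only assumed up to [q], so that [b] may
    be the reductions of the [p]-integral Bernoulli numbers. *)
Lemma Faulhaber (R : comNzRingType) (b : nat -> R) (q M : nat) :
    (forall n, (n <= q)%N ->
       \sum_(j < n.+1) 'C(n.+1, j)%:R * b j = (n == 0%N)%:R) ->
  q.+1%:R * \sum_(m < M) m%:R ^+ q =
  \sum_(j < q.+1) 'C(q.+1, j)%:R * b j * M%:R ^+ (q.+1 - j).
Proof.
move=> brec; elim: M => [|M IH].
  rewrite big_ord0 mulr0 big1 // => j _.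
  by rewrite expr0n subn_eq0 leqNgt ltn_ord mulr0.
rewrite big_ord_recr /= mulrDr {}IH; apply/esym/eqP.
rewrite addrC -subr_eq -sumrB; apply/eqP.
transitivity (\sum_(j < q.+1) \sum_(i < q.+1 | (i + j < q.+1)%N)
    'C(q.+1, i)%:R * M%:R ^+ i * ('C(q.+1 - i, j)%:R * b j)).
  apply: eq_bigr => j _; rewrite -mulrBr.
  have -> : M.+1%:R ^+ (q.+1 - j) - M%:R ^+ (q.+1 - j) =
      \sum_(i < q.+1 | (i + j < q.+1)%N) 'C(q.+1 - j, i)%:R * M%:R ^+ i :> R.
    rewrite -nat1r exprDn big_ord_recr /= subnn expr0 mul1r.
    rewrite binn mulr1n addrK.
    rewrite (big_ord_widen q.+1 (fun i =>
      1 ^+ (q.+1 - j - i) * M%:R ^+ i *+ 'C(q.+1 - j, i))) ?leq_subr //.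
    apply: eq_big => [i|i _]; first by rewrite ltn_subRL addnC.
    by rewrite expr1n mul1r mulr_natl.
  rewrite mulr_sumr; apply: eq_bigr => i ij.
  have := congr1 (fun n => n%:R : R) (@bin_mul_bin q.+1 i j (ltnW ij)).
  rewrite !natrM => e.
  transitivity ('C(q.+1, j)%:R * 'C(q.+1 - j, i)%:R * (b j * M%:R ^+ i)).
    ring.
  rewrite e; ring.
rewrite (exchange_big_dep xpredT) //= big_ord_recr /= [X in X + _]big1 ?add0r.
  rewrite (big_pred1 ord0) => [|j]; last first.
    by rewrite /= -val_eqE /=; have := ltn_ord j; lia.
  have := brec 0%N isT; rewrite big_ord1 /= bin0 mul1r => ->.
  by rewrite subSnn bin0 binSn; ring.
move=> i _; rewrite -mulr_sumr.
suff -> : \sum_(j < q.+1 | (i + j < q.+1)%N) 'C(q.+1 - i, j)%:R * b j = 0.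
  by rewrite mulr0.
have iq := ltn_ord i; have := brec (q - i)%N (leq_subr _ _).
have -> : (q - i == 0)%N = false by lia.
rewrite -subSn; last lia.
rewrite mulr0n => e0; rewrite -[RHS]e0.
rewrite (big_ord_widen q.+1 (fun j => 'C(q.+1 - i, j)%:R * b j)) ?leq_subr //.
by apply: eq_bigl => j; rewrite ltn_subRL.
Qed.

Definition sgn_ord (R : pzRingType) (p : nat) (u v : 'I_p) : R :=
  (v < u)%N%:R - (u < v)%N%:R.

Section BernoulliMod.
Variables (F : fieldType) (p : nat).
Hypothesis pcharF : p \in [pchar F].

Lemma natr_neq0_pchar n : (0 < n < p)%N -> n%:R != 0 :> F.
Proof.
by case/andP=> n0 np; rewrite -(dvdn_pcharf pcharF) gtnNdvd.
Qed.

(** The recursion computes [B_n] from earlier ones by dividing by [n + 1],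
    which is invertible modulo [p]. *)
Lemma bernoulli_reduces n :
  (n.+1 < p)%N -> rat_reduces (bernoulli n) (ratr (bernoulli n) : F).
Proof.
move=> np; suff [a ba] : exists a : F, rat_reduces (bernoulli n) a.
  by rewrite (rat_reduces_ratr ba).
elim/ltn_ind: n np => n IH np.
have {}IH j : (j < n)%N -> rat_reduces (bernoulli j) (ratr (bernoulli j) : F).
  by move=> jn; have [|a /[dup] /rat_reduces_ratr ->] := IH j jn; first lia.
case: n => [|n] in IH np *; first by exists 1; exact: (rat_reduces_int F 1).
have := bernoulli_rec n.+1; rewrite big_ord_recr /= => /eqP.
rewrite binSn addr_eq0 => /eqP e.
have -> : bernoulli n.+1 =
    (-1) * n.+2%:R^-1 * \sum_(i < n.+1) 'C(n.+2, i)%:R * bernoulli i.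
  by rewrite e mulrN mulN1r mulNr opprK mulKf // pnatr_eq0.
eexists; apply: rat_reducesM.
  apply: rat_reducesM; first exact: (rat_reduces_int F (-1)).
  by apply: rat_reducesV; apply: natr_neq0_pchar.
apply: rat_reduces_sum => i _; apply: rat_reducesM; last by apply: IH.
exact: (rat_reduces_int F 'C(n.+2, i)).
Qed.

Lemma bernoulli_rec_pchar n : (n.+1 < p)%N ->
  \sum_(j < n.+1) 'C(n.+1, j)%:R * (ratr (bernoulli j) : F) = (n == 0%N)%:R.
Proof.
move=> np.
have : rat_reduces (\sum_(j < n.+1) 'C(n.+1, j)%:R * bernoulli j)
  (\sum_(j < n.+1) 'C(n.+1, j)%:R * (ratr (bernoulli j) : F)).
  apply: rat_reduces_sum => i _; apply: rat_reducesM.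
    exact: (rat_reduces_int F 'C(n.+1, i)).
  by apply: bernoulli_reduces; have := ltn_ord i; lia.
rewrite bernoulli_rec => /rat_reduces_ratr <-.
exact: (rat_reduces_ratr (rat_reduces_int F (n == 0%N)%:Z)).
Qed.

Lemma natr_pred_pchar m : (0 < m < p)%N -> m%:R ^+ p.-1 = 1 :> F.
Proof.
move=> mp; have m0 := natr_neq0_pchar mp; apply: (mulfI m0).
rewrite mulr1 -exprS prednK; last lia.
by have := pFrobenius_aut_nat pcharF m; rewrite pFrobenius_autE.
Qed.

(** At [m = 0] both sides are zero, as [0^-1 = 0] and both exponents are
    positive; so sums over nonzero residues may run over all of ['I_p]. *)
Lemma natrXV_pchar a m : (0 < a < p.-1)%N -> (m < p)%N ->
  (m%:R ^+ a)^-1 = m%:R ^+ (p.-1 - a) :> F.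
Proof.
move=> ap; case: m => [|m] mp.
  have [a0 pa0] : (a == 0)%N = false /\ (p.-1 - a == 0)%N = false by lia.
  by rewrite !expr0n a0 pa0 invr0.
have m0 : m.+1%:R != 0 :> F by exact: natr_neq0_pchar.
apply: (mulfI (expf_neq0 a m0)); rewrite -exprD divff ?expf_neq0 //.
by rewrite subnKC ?natr_pred_pchar //; lia.
Qed.

(** Faulhaber's polynomial in [M] has no constant term, and [M = p] is zero
    in [F]. *)
Lemma sum_natrX_pchar q : (q.+1 < p)%N -> \sum_(m < p) m%:R ^+ q = 0 :> F.
Proof.
move=> qp; apply: (mulfI (natr_neq0_pchar (n := q.+1) qp)); rewrite mulr0.
rewrite (@Faulhaber _ (fun j => ratr (bernoulli j))) => [|n nq]; last first.
  by apply: bernoulli_rec_pchar; lia.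
apply: big1 => j _; rewrite (pcharf0 pcharF) expr0n subn_eq0 leqNgt ltn_ord.
by rewrite mulr0.
Qed.

(** Exponents below [2 (p - 1)] are what the evaluation of double zeta values
    produces; those above [p - 1] reduce by Fermat's little theorem. *)
Lemma sum_natrX_pchar_lt e : (0 < e < p.-1.*2)%N ->
  \sum_(m < p) m%:R ^+ e = - (e == p.-1)%:R :> F.
Proof.
move=> ep; have p_gt1 := prime_gt1 (pcharf_prime pcharF).
case: (ltngtP e p.-1) => [lt_e|gt_e|->].
- by rewrite sum_natrX_pchar ?oppr0 //; lia.
- rewrite oppr0 -[RHS](@sum_natrX_pchar (e - p.-1)); last lia.
  apply: eq_bigr => -[[|m] mp] _ /=; first by rewrite !expr0n; congr (_%:R); lia.
  by rewrite -{1}(subnK (ltnW gt_e)) exprD natr_pred_pchar ?mulr1.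
apply/eqP; rewrite -addr_eq0; apply/eqP.
rewrite -[RHS](@sum_natrX_pchar 0) //.
have p0 : (0 < p)%N by lia.
rewrite (bigD1 (Ordinal p0)) // [RHS](bigD1 (Ordinal p0)) //= !expr0n.
rewrite (_ : (p.-1 == 0)%N = false) ?add0r; last lia.
rewrite addrC; congr (_ + _); apply: eq_bigr => m m0; rewrite expr0.
rewrite natr_pred_pchar // ltn_ord andbT lt0n; exact: m0.
Qed.

Lemma sum_natrXV_pchar a : (0 < a < p.-1)%N ->
  \sum_(m < p) (m%:R ^+ a)^-1 = 0 :> F.
Proof.
move=> ap; rewrite -[RHS](@sum_natrX_pchar (p.-1 - a)); last lia.
by apply: eq_bigr => m _; rewrite natrXV_pchar.
Qed.

(** Modulo [p], ['C(p - a, b)] is the generalized binomial coefficient of [- a]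
    over [b], that is, [(-1)^b 'C(a + b - 1, b)]; the factors [a + b] and [a]
    clear the denominators in passing to ['C(a + b, b)]. *)
Lemma bin_subn_pchar a b : (0 < a)%N -> (a + b < p)%N ->
  'C(p - a, b)%:R * (a + b)%:R = (-1) ^+ b * 'C(a + b, b)%:R * a%:R :> F.
Proof.
move=> a0; elim: b => [|b IH] abp; first by rewrite !bin0 addn0 expr0 !mul1r.
have b0 : b.+1%:R != 0 :> F by apply: natr_neq0_pchar; lia.
apply: (mulfI b0).
have := congr1 (fun n => n%:R : F) (mul_bin_left (p - a) b).
have := congr1 (fun n => n%:R : F) (mul_bin_diag (a + b).+1 b).
rewrite !natrM /= => diag left.
rewrite mulrA left -subnDA natrB; last lia.
rewrite (pcharf0 pcharF) sub0r mulNr [(a + b)%:R * _]mulrC IH; last lia.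
rewrite addnS !mulrA.
transitivity (- (-1) ^+ b * a%:R * ((a + b).+1%:R * 'C(a + b, b)%:R) : F).
  ring.
rewrite diag exprS; ring.
Qed.

(** The inner sum is [sum_(u < v) u^(p - 1 - a)], a polynomial in [v] by
    Faulhaber's formula.  Multiplying it by [v^(p - 1 - b)] and summing over
    [v] kills every power except [v^(p - 1)], that is, leaves the term of
    [B_(p - a - b)]. *)
Lemma double_sum_natrXV_pchar a b :
    (0 < a)%N -> (0 < b)%N -> ((a + b).+1 < p)%N ->
  \sum_(u < p) \sum_(v < p | (u < v)%N)
     (u%:R ^+ a)^-1 * (v%:R ^+ b)^-1 =
  (-1) ^+ b * 'C(a + b, b)%:R * ratr (bernoulli (p - (a + b)) / (a + b)%:R) :> F.
Proof.
move=> a0 b0 abp; set k := (a + b)%N.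
have -> : ratr (bernoulli (p - k) / k%:R) = ratr (bernoulli (p - k)) / k%:R :> F.
  apply/rat_reduces_ratr/rat_reducesM; first by apply: bernoulli_reduces; lia.
  by apply/rat_reducesV/natr_neq0_pchar; lia.
have a_neq0 : a%:R != 0 :> F by apply: natr_neq0_pchar; lia.
have k_neq0 : k%:R != 0 :> F by apply: natr_neq0_pchar; lia.
rewrite (exchange_big_dep xpredT) //=.
have inner (v : 'I_p) :
    \sum_(u < p | (u < v)%N) (u%:R ^+ a)^-1 * (v%:R ^+ b)^-1 =
    - a%:R^-1 * \sum_(j < p - a) 'C(p - a, j)%:R * ratr (bernoulli j) *
       v%:R ^+ (p - a - j + (p.-1 - b)) :> F.
  rewrite -mulr_suml natrXV_pchar //; last lia.
  have -> : \sum_(u < p | (u < v)%N) (u%:R ^+ a)^-1 =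
      \sum_(u < v) u%:R ^+ (p.-1 - a) :> F.
    rewrite (big_ord_widen p (fun u => u%:R ^+ (p.-1 - a) : F) (ltnW (ltn_ord v))).
    by apply: eq_bigr => u _; rewrite natrXV_pchar //; lia.
  have := @Faulhaber F (fun j => ratr (bernoulli j)) (p.-1 - a) v.
  rewrite -subSn ?prednK; try lia.
  rewrite natrB ?(pcharf0 pcharF) ?sub0r; last lia.
  move=> faul; apply: (mulfI (x := - a%:R)); first by rewrite oppr_eq0.
  rewrite mulrA faul => [|n na]; last by apply: bernoulli_rec_pchar; lia.
  rewrite mulrA mulrNN divff // mul1r mulr_suml; apply: eq_bigr => j _.
  by rewrite exprD mulrA.
rewrite (eq_bigr _ (fun v _ => inner v)) -mulr_sumr exchange_big /=.
have pkp : (p - k < p - a)%N by lia.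
rewrite (bigD1 (Ordinal pkp)) //= [X in _ + X]big1 ?addr0; last first.
  move=> j; rewrite -val_eqE /= => jk; rewrite -mulr_sumr sum_natrX_pchar_lt.
    rewrite (_ : (_ == _) = false) ?oppr0 ?mulr0 //.
    by have := ltn_ord j; lia.
  by have := ltn_ord j; lia.
rewrite -mulr_sumr sum_natrX_pchar_lt; last lia.
rewrite (_ : (_ == _) = true) ?mulr1n; last lia.
have := bin_subn_pchar a0 (b := b); rewrite -/k => /(_ ltac:(lia)).
have -> : 'C(p - a, p - k) = 'C(p - a, b) by rewrite -bin_sub; [congr 'C(_, _)|]; lia.
move=> e; transitivity (('C(p - a, b)%:R * k%:R) *
    (ratr (bernoulli (p - k)) / (a%:R * k%:R)) : F).
  by field; rewrite a_neq0 k_neq0.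
by rewrite e; field; rewrite k_neq0.
Qed.

(** Write [D_<], [D_>], [D_=] for the sums over [u < v], [u > v], [u = v].
    Their total is a product of two vanishing power sums and [D_=] is itself a
    power sum, so [D_< = - D_>] and the signed sum is [2 D_>]. *)
Lemma sgn_double_sum_pchar a b : (0 < a)%N -> (0 < b)%N -> ((a + b).+1 < p)%N ->
  \sum_(u < p) \sum_(v < p) sgn_ord F u v * ((u%:R ^+ a)^-1 * (v%:R ^+ b)^-1) =
  2 * ((-1) ^+ a * 'C(a + b, a)%:R * ratr (bernoulli (p - (a + b)) / (a + b)%:R)).
Proof.
move=> a0 b0 abp.
pose D (P : rel nat) : F :=
  \sum_(u < p) \sum_(v < p | P u v) (u%:R ^+ a)^-1 * (v%:R ^+ b)^-1.
have gtE : D (fun u v => v < u)%N =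
    (-1) ^+ a * 'C(a + b, a)%:R * ratr (bernoulli (p - (a + b)) / (a + b)%:R).
  rewrite addnC -(double_sum_natrXV_pchar b0 a0) 1?addnC // /D.
  rewrite (exchange_big_dep xpredT) //=; apply: eq_bigr => v _.
  by apply: eq_bigr => u _; rewrite mulrC.
have eqE : D (fun u v => u == v) = 0.
  rewrite -[RHS](sum_natrXV_pchar (a := a + b)); last lia.
  apply: eq_bigr => u _; rewrite (big_pred1 u) => [|v]; last by rewrite eq_sym.
  by rewrite exprD invfM mulrC.
have allE : D (fun _ _ => true) = 0.
  rewrite -[RHS](mul0r (\sum_(v < p) (v%:R ^+ b)^-1)).
  rewrite -[X in _ = X * _](sum_natrXV_pchar (a := a)); last lia.
  by rewrite mulr_suml; apply: eq_bigr => u _; rewrite mulr_sumr.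
have splitE : D (fun _ _ => true) =
    D (fun u v => u == v) + D (fun u v => v < u)%N + D (fun u v => u < v)%N.
  rewrite -!big_split /=; apply: eq_bigr => u _.
  rewrite [X in _ = X + _ + _]big_mkcond [X in _ = _ + X + _]big_mkcond.
  rewrite [X in _ = _ + X]big_mkcond -!big_split; apply: eq_bigr => v _ /=.
  by case: ltngtP; rewrite ?addr0 ?add0r.
transitivity (D (fun u v => v < u)%N - D (fun u v => u < v)%N).
  rewrite /D -sumrB; apply: eq_bigr => u _.
  rewrite [X in _ = X - _]big_mkcond [X in _ = _ - X]big_mkcond.
  rewrite -sumrB; apply: eq_bigr => v _; rewrite /sgn_ord.
  by case: ltngtP; rewrite ?mulrBl ?mul1r ?mul0r ?subr0 ?sub0r.
move: splitE; rewrite allE eqE add0r => /esym/eqP; rewrite addrC addr_eq0 => /eqP ->.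
by rewrite opprK gtE; ring.
Qed.

End BernoulliMod.

(** * Sums over injective families *)

Lemma sum_subsets_pick (R : nmodType) (I : finType) (J : {set I})
    (H : I -> {set I} -> R) :
  \sum_(i in J) \sum_(B : {set I} | B \subset J :\ i) H i (i |: B) =
  \sum_(A : {set I} | A \subset J) \sum_(i in A) H i A.
Proof.
rewrite (exchange_big_dep (mem J)) /= => [|A i AJ iA]; last exact: (subsetP AJ).
apply: eq_bigr => i iJ.
rewrite [RHS](reindex_onto (fun B => i |: B) (fun A => A :\ i)) /=; last first.
  by move=> A /andP[_ iA]; rewrite setD1K.
apply: eq_bigl => B; rewrite setU11 andbT subsetD1 subUset sub1set iJ /=.
congr (_ && _); apply/idP/eqP => [iB|<-]; last by rewrite !inE eqxx.
by rewrite setU1K.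
Qed.

Section Placements.
Variables (R : comNzRingType) (I V : finType) (x : I -> V -> R).
Implicit Types (g f : {ffun I -> V}) (U : {set V}) (J : {set I}).

(** Families [f] that are injective on [J] and avoid [U] there.  Their values
    off [J] are pinned to those of [g] so that each partial family on [J] is
    counted once while staying in a fixed finite type; the sums below do not
    depend on [g]. *)
Definition placement g U J f : bool :=
  [&& [forall i, (i \notin J) ==> (f i == g i)],
      dinjectiveb f (mem J) & [forall i in J, f i \notin U]].

Lemma placementP g U J f :
  reflect [/\ forall i, i \notin J -> f i = g i, {in J &, injective f}
            & forall i, i \in J -> f i \notin U] (placement g U J f).
Proof.
apply: (iffP and3P) => -[fg fJ fU]; split.
- by move=> i iJ; apply/eqP; exact: (implyP (forallP fg i) iJ).
- exact/dinjectiveP.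
- exact/forall_inP.
- by apply/forallP=> i; apply/implyP=> iJ; apply/eqP/fg.
- exact/dinjectiveP.
- exact/forall_inP.
Qed.

Definition placement_sum g U J : R :=
  \sum_(f | placement g U J f) \prod_(i in J) x i (f i).

Definition set_value g i w : {ffun I -> V} :=
  [ffun j => if j == i then w else g j].

(** Fixing the value of a placement at one index leaves a placement of the
    remaining indices that also avoids this value; every recursion below comes
    from this equivalence. *)
Lemma placement_pin g U J f i w : i \in J ->
  placement g U J f && (f i == w) =
  (w \notin U) && placement (set_value g i w) (w |: U) (J :\ i) f.
Proof.
move=> iJ; apply/andP/andP => [[/placementP[fg fJ fU] /eqP <-]|].
  split; first exact: fU.
  apply/placementP; split=> [j|j l|j]; rewrite !inE ?ffunE ?negb_or ?negb_and ?negbK.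
  - by have [->|] := eqVneq j i => //= _ /fg.
  - by move=> /andP[_ jJ] /andP[_ lJ]; apply: fJ.
  - by case/andP=> ji jJ; rewrite (inj_in_eq fJ) // ji fU.
case=> wU /placementP[fg fJ fU].
have fi : f i = w by rewrite fg ?setD11 // ffunE eqxx.
have fU' j : j \in J -> j != i -> (f j != w) && (f j \notin U).
  by move=> jJ ji; have := fU j; rewrite !inE negb_or ji jJ; apply.
rewrite fi; split=> //; apply/placementP; split=> [j jJ|j l jJ lJ|j jJ].
- rewrite fg ?inE ?(negPf jJ) ?andbF // ffunE.
  by case: eqVneq jJ => // ->; rewrite iJ.
- have [->|ji] := eqVneq j i; have [->|li] := eqVneq l i => //.
  + by rewrite fi => e; have := fU' l lJ li; rewrite -e eqxx.
  + by rewrite fi => e; have := fU' j jJ ji; rewrite e eqxx.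
  + by apply: fJ; rewrite !inE ?ji ?li.
- by have [->|ji] := eqVneq j i; [rewrite fi | case/andP: (fU' j jJ ji)].
Qed.

Lemma placement_sum0 g U : placement_sum g U set0 = 1.
Proof.
rewrite /placement_sum (big_pred1 g) ?big_set0 // => f; apply/placementP/eqP.
  by case=> fg _ _; apply/ffunP => i; rewrite fg ?inE.
by move->; split=> // [i j|i]; rewrite inE.
Qed.

Lemma sum_placement_pin g U J i w (G : {ffun I -> V} -> R) : i \in J -> w \notin U ->
  \sum_(f | placement g U J f && (f i == w)) G f =
  \sum_(f | placement (set_value g i w) (w |: U) (J :\ i) f) G f.
Proof. by move=> iJ wU; apply: eq_bigl => f; rewrite placement_pin // wU. Qed.

Lemma placement_sum_pin g U J i w : i \in J -> w \notin U ->
  \sum_(f | placement g U J f && (f i == w)) \prod_(j in J) x j (f j) =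
  x i w * placement_sum (set_value g i w) (w |: U) (J :\ i).
Proof.
move=> iJ wU; rewrite mulr_sumr -sum_placement_pin //.
by apply: eq_bigr => f /andP[_ /eqP <-]; rewrite (big_setD1 i).
Qed.

Lemma placement_sum_index g U J i : i \in J ->
  placement_sum g U J = \sum_(w | w \notin U)
     x i w * placement_sum (set_value g i w) (w |: U) (J :\ i).
Proof.
move=> iJ; rewrite /placement_sum.
rewrite (partition_big (fun f => f i) (fun w => w \notin U)) /=; last first.
  by move=> f /placementP[_ _]; apply.
by apply: eq_bigr => w wU; rewrite placement_sum_pin.
Qed.

(** By injectivity, a placement either avoids [u] or takes it at exactly one
    index. *)
Lemma placement_sum_value g U J u : u \notin U ->
  placement_sum g U J = placement_sum g (u |: U) J +
    \sum_(i in J) x i u * placement_sum (set_value g i u) (u |: U) (J :\ i).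
Proof.
move=> uU; rewrite {1}/placement_sum.
under [X in _ + X]eq_bigr do rewrite -placement_sum_pin //.
rewrite (exchange_big_dep (placement g U J)) /=; last by move=> i f _ /andP[].
rewrite /placement_sum (bigID (fun f => [forall i in J, f i != u])) /=.
rewrite [X in _ = _ + X](bigID (fun f => [forall i in J, f i != u])) /=.
rewrite [X in _ = _ + (X + _)]big1 => [|f /andP[fJ /forall_inP fu]]; last first.
  by apply: big_pred0 => i; apply: contraTF isT => /and3P[/fu/negPf->].
rewrite add0r; congr (_ + _).
  apply: eq_bigl => f; rewrite /placement -!andbA; do 2 congr (_ && _).
  rewrite andbC; apply/andP/forall_inP => [[/forall_inP fu /forall_inP fU] i iJ|fU].
    by rewrite !inE negb_or fu ?fU.
  by split; apply/forall_inP => i /fU; rewrite !inE negb_or => /andP[].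
apply: eq_bigr => f /andP[fP]; rewrite negb_forall_in => /exists_inP[i iJ].
rewrite negbK => /eqP fi; rewrite [RHS](big_pred1 i) // => j /=.
rewrite fP /=; apply/andP/eqP => [[jJ /eqP fj]|->]; last by rewrite iJ fi.
by case/placementP: fP => _ fJ _; apply: fJ; rewrite ?fi ?fj.
Qed.

Hypothesis power_sum0 : forall A : {set I}, A != set0 ->
  \sum_w \prod_(i in A) x i w = 0.

(** The polarised form of [1 / (1 + u t)].  Choosing first the value at one
    index, the formula for smaller [J] shows that the unrestricted sum over [J]
    is a multiple of the power sum of [J], hence zero; then
    [placement_sum_value] gives the formula for [J] itself. *)
Lemma placement_sum_avoid1 g J u :
  placement_sum g [set u] J = (-1) ^+ #|J| * #|J|`!%:R * \prod_(i in J) x i u.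
Proof.
have [n] := ubnP #|J|; elim: n g J u => // n IH g J u /ltnSE Jn.
have [->|[i iJ]] := set_0Vmem J.
  by rewrite placement_sum0 cards0 big_set0 expr0 !mul1r.
have Ji : #|J| = #|J :\ i|.+1 by rewrite (cardsD1 i) iJ.
have J0 : placement_sum g set0 J = 0.
  rewrite (placement_sum_index g set0 iJ).
  under eq_bigr => w _.
    rewrite setU0 IH; last by rewrite -Ji.
    rewrite mulrCA -(big_setD1 i iJ (F := fun i => x i w)).
    over.
  rewrite (eq_bigl xpredT) => [|w]; last by rewrite inE.
  by rewrite -mulr_sumr power_sum0 ?mulr0 //; apply/set0Pn; exists i.
have := @placement_sum_value g set0 J u; rewrite in_set0 => /(_ isT).
rewrite J0 setU0 => /esym/eqP; rewrite addr_eq0 => /eqP ->.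
rewrite (eq_bigr (fun=> (-1) ^+ #|J|.-1 * (#|J|.-1)`!%:R * \prod_(i in J) x i u)).
  by rewrite sumr_const Ji /= factS natrM exprS -mulr_natl; ring.
move=> j jJ; have Jj : #|J| = #|J :\ j|.+1 by rewrite (cardsD1 j) jJ.
rewrite IH; last by rewrite -Jj.
by rewrite mulrCA -(big_setD1 j jJ (F := fun i => x i u)) Jj.
Qed.

(** The polarised form of [1 / ((1 + u t) (1 + v t))]. *)
Lemma placement_sum_avoid2 g J u v : u != v ->
  placement_sum g [set u; v] J =
  (-1) ^+ #|J| * \sum_(A : {set I} | A \subset J)
    (#|A|`! * #|J :\: A|`!)%:R *
    ((\prod_(i in A) x i u) * \prod_(i in J :\: A) x i v).
Proof.
move=> uv; have [n] := ubnP #|J|; elim: n g J => // n IH g J /ltnSE Jn.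
have uNv : u \notin [set v] by rewrite inE.
(* The sum avoiding [v] alone is the term [A = set0] of the formula. *)
have := placement_sum_value g J uNv; rewrite placement_sum_avoid1.
move=> /esym/eqP; rewrite eq_sym -subr_eq => /eqP <-.
pose t (A : {set I}) : R := ((#|A|.-1)`! * #|J :\: A|`!)%:R *
    ((\prod_(i in A) x i u) * \prod_(i in J :\: A) x i v).
have -> :
    \sum_(i in J) x i u * placement_sum (set_value g i u) [set u; v] (J :\ i) =
    \sum_(i in J) \sum_(B : {set I} | B \subset J :\ i)
       (-1) ^+ #|J|.-1 * t (i |: B).
  apply: eq_bigr => i iJ.
  have Ji : #|J| = #|J :\ i|.+1 by rewrite (cardsD1 i) iJ.
  rewrite IH -?Ji // {1}Ji /= mulrCA -[RHS]mulr_sumr; congr (_ * _); rewrite mulr_sumr.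
  apply: eq_bigr => B; rewrite subsetD1 => /andP[BJ iB].
  by rewrite /t cardsU1 iB big_setU1 //= setDDl; ring.
rewrite (sum_subsets_pick J (fun _ A => (-1) ^+ #|J|.-1 * t A)).
rewrite [in RHS](bigD1 set0) ?sub0set //= cards0 setD0 big_set0 !mul1r mul1n.
rewrite [X in _ - X](bigD1 set0) ?sub0set //= big_set0 add0r mulrDr mulrA; congr (_ + _).
rewrite mulr_sumr -sumrN; apply: eq_bigr => A /andP[AJ A0].
have A_gt0 : (0 < #|A|)%N by rewrite card_gt0.
have J_gt0 : (0 < #|J|)%N := leq_trans A_gt0 (subset_leq_card AJ).
rewrite sumr_const -(prednK J_gt0) exprS /t -(prednK A_gt0) /= factS !natrM -mulr_natl.
ring.
Qed.


Lemma placement_setT g f : placement g set0 [set: I] f = injectiveb f.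
Proof.
apply/placementP/injectiveP => [[_ finj _]|finj].
  by move=> i j; apply: finj; rewrite inE.
by split=> [i|i j _ _|i]; rewrite ?inE //; exact: finj.
Qed.

(** The sum over the values [v] at [r] and [u] at [i], the other indices being
    summed by [placement_sum_avoid2].  The pairs [u = v] contribute nothing as
    [c] vanishes on the diagonal, so they are included in the result. *)
Lemma sum_injective_pair (c : V -> V -> R) (r i : I) (g : {ffun I -> V}) :
    i != r -> (forall v, c v v = 0) ->
  \sum_(f : {ffun I -> V} | injectiveb f) c (f i) (f r) * \prod_j x j (f j) =
  (-1) ^+ #|I| * \sum_(B : {set I} | B \subset [set~ r] :\ i)
    (#|B|`! * #|[set~ r] :\ i :\: B|`!)%:R *
    \sum_u \sum_v c u v * ((\prod_(j in i |: B) x j u) *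
                           \prod_(j in ~: (i |: B)) x j v).
Proof.
move=> ir cvv; set J := [set~ r] :\ i.
have iK : i \in [set~ r] by rewrite !inE.
have JE : [set: I] :\ r :\ i = J by rewrite setTD.
have cardJ : #|I| = #|J|.+2.
  by rewrite -cardsT (cardsD1 r) inE (cardsD1 i) setTD iK.
have split_r :
    \sum_(f : {ffun I -> V} | injectiveb f) c (f i) (f r) * \prod_j x j (f j) =
    \sum_v \sum_u c u v * (x r v * (x i u * \sum_(B : {set I} | B \subset J)
      (-1) ^+ #|J| * ((#|B|`! * #|J :\: B|`!)%:R *
        ((\prod_(j in B) x j u) * \prod_(j in J :\: B) x j v)))).
  rewrite (eq_bigl (placement g set0 setT)) => [|f]; last by rewrite placement_setT.
  rewrite (partition_big (fun f => f r) xpredT) //=; apply: eq_bigr => v _.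
  rewrite sum_placement_pin ?inE // setU0.
  rewrite (partition_big (fun f => f i) (fun u => u != v)) /=; last first.
    by move=> f /placementP[_ _ /(_ i)]; rewrite !inE ir => /(_ isT).
  rewrite big_mkcond /=; apply: eq_bigr => u _.
  case: eqVneq => [->|uv] /=; first by rewrite cvv mul0r.
  rewrite -mulr_sumr -(placement_sum_avoid2 (set_value (set_value g r v) i u) J uv).
  have fr f : placement (set_value g r v) [set v] (setT :\ r) f -> f r = v.
    by case/placementP=> -> //; rewrite ?ffunE ?eqxx // setD11.
  transitivity
    (\sum_(f | placement (set_value g r v) [set v] (setT :\ r) f && (f i == u))
      c u v * (x r v * \prod_(j in setT :\ r) x j (f j))).
    apply: eq_bigr => f /andP[fP /eqP fi].
    rewrite fi -(fr f fP) -(big_setD1 r (F := fun j => x j (f j))) ?inE //.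
    by congr (_ * _); apply: eq_bigl => j; rewrite inE.
  by rewrite -!mulr_sumr placement_sum_pin ?inE ?ir // JE.
rewrite {}split_r exchange_big /= cardJ.
transitivity (\sum_u \sum_v \sum_(B : {set I} | B \subset J)
    (-1) ^+ #|J|.+2 * ((#|B|`! * #|J :\: B|`!)%:R *
    (c u v * ((\prod_(j in i |: B) x j u) * \prod_(j in ~: (i |: B)) x j v)))).
  apply: eq_bigr => u _; apply: eq_bigr => v _; rewrite !mulr_sumr.
  apply: eq_bigr => B; rewrite subsetD1 => /andP[BK iB].
  have BrE : ~: (i |: B) :\ r = J :\: B.
    apply/setP=> j; rewrite /J !inE negb_or.
    by case: (j == r); case: (j == i); case: (j \in B).
  have rB : r \notin B by apply/negP => /(subsetP BK); rewrite !inE eqxx.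
  rewrite (big_setU1 _ iB) (big_setD1 r (A := ~: _)) /= ?BrE; last first.
    by rewrite !inE negb_or eq_sym ir.
  by rewrite !exprS; ring.
rewrite mulr_sumr; under eq_bigr do rewrite exchange_big /=.
rewrite exchange_big /=; apply: eq_bigr => B _.
by rewrite !mulr_sumr; apply: eq_bigr => u _; rewrite !mulr_sumr.
Qed.

(** A set [A] arises as [i |: B] once for each of its elements, which turns the
    weight [(|A| - 1)!] into [|A|!]. *)
Lemma sum_injective_pairs (c : V -> V -> R) (r : I) (g : {ffun I -> V}) :
    (forall v, c v v = 0) ->
  \sum_(f : {ffun I -> V} | injectiveb f)
     (\sum_(i | i != r) c (f i) (f r)) * \prod_j x j (f j) =
  (-1) ^+ #|I| * \sum_(A : {set I} | (A \subset [set~ r]) && (A != set0))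
    (#|A|`! * #|[set~ r] :\: A|`!)%:R *
    \sum_u \sum_v c u v * ((\prod_(j in A) x j u) * \prod_(j in ~: A) x j v).
Proof.
move=> cvv.
under eq_bigr do rewrite mulr_suml.
rewrite exchange_big /=.
under eq_bigr => i ir do rewrite (sum_injective_pair g ir cvv).
rewrite -mulr_sumr; congr (_ * _).
pose h (A : {set I}) : R := ((#|A|.-1)`! * #|[set~ r] :\: A|`!)%:R *
    \sum_u \sum_v c u v * ((\prod_(j in A) x j u) * \prod_(j in ~: A) x j v).
transitivity (\sum_(i in [set~ r])
    \sum_(B : {set I} | B \subset [set~ r] :\ i) h (i |: B)).
  apply: eq_big => [i|i _]; first by rewrite !inE.
  apply: eq_bigr => B; rewrite subsetD1 => /andP[_ iB].
  by rewrite /h cardsU1 iB setDDl.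
rewrite (sum_subsets_pick _ (fun _ A => h A)) (bigD1 set0) ?sub0set //= big_set0 add0r.
apply: eq_bigr => A /andP[_ A0]; have A_gt0 : (0 < #|A|)%N by rewrite card_gt0.
rewrite sumr_const -[LHS]mulr_natl /h mulrA -natrM mulnA.
by rewrite -{1}(prednK A_gt0) -factS prednK.
Qed.

End Placements.

(** * Orderings and ranks *)

Section Ranks.
Variables n p : nat.
Implicit Types (f m : {ffun 'I_n -> 'I_p}) (s : 'S_n).

Definition increasing f : bool :=
  [forall i : 'I_n, forall j : 'I_n, (i < j)%N ==> (f i < f j)%N].

Lemma increasingP f :
  reflect (forall i j : 'I_n, (i < j)%N -> (f i < f j)%N) (increasing f).
Proof.
apply: (iffP forallP) => [fP i j|fP i]; first exact/implyP/(forallP (fP i)).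
by apply/forallP => j; apply/implyP/fP.
Qed.

Definition rank f i : nat := #|[set j | (f j < f i)%N]|.

Definition fcomp f s : {ffun 'I_n -> 'I_p} := [ffun i => f (s i)].

Lemma increasing_rank f s i : increasing (fcomp f s) -> (s^-1)%g i = rank f i :> nat.
Proof.
move=> /increasingP fs; rewrite /rank.
have -> : [set j | (f j < f i)%N] = s @: [set q : 'I_n | (q < (s^-1)%g i)%N].
  apply/setP => j; rewrite -(permKV s j) mem_imset; last exact: perm_inj.
  rewrite !inE permKV; set q := (s^-1)%g j; set q' := (s^-1)%g i.
  have := fs q q'; have := fs q' q; rewrite !ffunE !permKV => gt lt.
  case: (ltngtP q q') => [/lt|/gt|/val_inj/perm_inj ->] //; last by rewrite ltnn.
  by move=> fij; rewrite ltnNge ltnW.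
rewrite card_imset; last exact: perm_inj.
rewrite cardsE -sum1_card (big_ord_narrow (F := fun=> 1%N) (ltnW (ltn_ord _))).
by rewrite sum1_card card_ord.
Qed.

Lemma ltn_rank f i j : (f i < f j)%N -> (rank f i < rank f j)%N.
Proof.
move=> fij; apply: proper_card; apply/properP; split.
  by apply/subsetP => l; rewrite !inE => /ltn_trans; apply.
by exists i; rewrite !inE ?ltnn.
Qed.

Lemma rank_ltn f i : (rank f i < n)%N.
Proof.
rewrite -[X in (_ < X)%N]card_ord -cardsT; apply: proper_card; apply/properP.
by split; [exact: subsetT | exists i; rewrite !inE ?ltnn].
Qed.

(** The ranks of an injective family are distinct, so they form a permutation;
    its inverse sorts the family. *)
Lemma increasing_perm_exists f : injective f -> exists s, increasing (fcomp f s).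
Proof.
move=> f_inj; pose r i := Ordinal (rank_ltn f i).
have r_inj : injective r.
  move=> i j /(congr1 val) /= rij; apply/f_inj/val_inj.
  by case: (ltngtP (f i) (f j)) => // /ltn_rank; rewrite rij ltnn.
set s := ((perm r_inj)^-1)%g.
exists s; apply/increasingP => q q'; rewrite !ffunE; set i := s q; set j := s q'.
have -> : q = rank f i :> nat by rewrite -[q](permKV (perm r_inj)) permE.
have -> : q' = rank f j :> nat by rewrite -[q'](permKV (perm r_inj)) permE.
case: (ltngtP (f i) (f j)) => // [/ltn_rank|/val_inj/f_inj ->]; last by rewrite ltnn.
by move=> /ltnW; rewrite leqNgt => /negP.
Qed.

(** Each injective family [f] is [m \o s^-1] for exactly one pair of a
    permutation [s] and an increasing [m]: [s] exists by sorting, and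
    [increasing_rank] determines it. *)
Lemma sum_perm_increasing (R : pzRingType) (i0 : 'I_n) (c : nat -> R)
    (H : {ffun 'I_n -> 'I_p} -> R) :
  \sum_(s : 'S_n) c ((s^-1)%g i0) * \sum_(m | increasing m) H (fcomp m s^-1%g) =
  \sum_(f : {ffun 'I_n -> 'I_p} | injectiveb f) c (rank f i0) * H f.
Proof.
have fcompK s : cancel (fcomp^~ s) (fcomp^~ s^-1%g).
  by move=> f; apply/ffunP => i; rewrite !ffunE permKV.
have fcompVK s : cancel (fcomp^~ s^-1%g) (fcomp^~ s).
  by move=> f; apply/ffunP => i; rewrite !ffunE permK.
transitivity (\sum_(s : 'S_n) \sum_(f | increasing (fcomp f s)) c (rank f i0) * H f).
  apply: eq_bigr => s _; rewrite mulr_sumr (reindex (fcomp^~ s)) /=; last first.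
    by exists (fcomp^~ s^-1%g) => f _; [exact: fcompK | exact: fcompVK].
  by apply: eq_bigr => f fs; rewrite fcompK (increasing_rank _ fs).
have incr_inj f s : increasing (fcomp f s) -> injectiveb f.
  move=> /increasingP fs; apply/injectiveP => i j fij.
  have := fs ((s^-1)%g i) ((s^-1)%g j); have := fs ((s^-1)%g j) ((s^-1)%g i).
  rewrite !ffunE !permKV fij ltnn => gt lt.
  apply: (@perm_inj _ s^-1%g); apply/val_inj.
  by case: (ltngtP ((s^-1)%g i) ((s^-1)%g j)) => [/lt|/gt|].
rewrite (exchange_big_dep (fun f : {ffun _} => injectiveb f)) /=; last first.
  by move=> s f _; exact: incr_inj.
apply: eq_bigr => f /injectiveP /increasing_perm_exists[s fs].
rewrite (big_pred1 s) // => t /=; apply/idP/eqP => [ft|-> //].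
apply: invg_inj; apply/permP => i; apply/val_inj.
by rewrite /= (increasing_rank i ft) (increasing_rank i fs).
Qed.

End Ranks.

(** As [f] is injective, [n] is the number of values above [f r] plus the
    number [rank f r] of values below it. *)
Lemma sum_sgn_rank (R : comPzRingType) (n p : nat) (f : {ffun 'I_n.+1 -> 'I_p})
    (r : 'I_n.+1) : injective f ->
  (n.+1%:Z + 1 - 2 * (rank f r).+1%:Z)%:~R =
  \sum_(i | i != r) sgn_ord R (f i) (f r).
Proof.
move=> f_inj; rewrite sumrB.
have count (P : pred 'I_n.+1) : P r = false ->
    \sum_(i | i != r) (P i)%:R = #|[set i | P i]|%:R :> R.
  move=> Pr; rewrite -sum1_card natr_sum big_mkcond [RHS]big_mkcond.
  apply: eq_bigr => i _; rewrite inE; case: eqVneq => [->|_]; last by case: (P i).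
  by rewrite Pr.
rewrite !count ?ltnn // -/(rank f r).
have : (#|[set i | (f r < f i)%N]| + rank f r)%N = n.
  rewrite /rank -cardsUI [X in (_ + X)%N](_ : _ = 0%N) ?addn0; last first.
    by apply: eq_card0 => i; rewrite !inE; case: ltngtP.
  rewrite (_ : _ :|: _ = [set~ r]) ?cardsC1 ?card_ord //.
  apply/setP => i; rewrite !inE -(inj_eq f_inj) -val_eqE /=.
  by rewrite neq_ltn orbC.
move: (rank f r) #|_| => l g <-; rewrite -[_.+1]addn1 -[l.+1]addn1 !PoszD.
by rewrite !(rmorphD, rmorphB, rmorphM) /= -!pmulrn; ring.
Qed.

(** * Counting permutations by their first values *)

(** The lists [X ++ ~: X] and [Y ++ ~: Y] both enumerate [T]; matching them
    entry by entry gives the permutation. *)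
Lemma imset_perm_exists (T : finType) (X Y : {set T}) :
  #|X| = #|Y| -> exists s : {perm T}, s @: X = Y.
Proof.
move=> cXY; pose e (Z : {set T}) := enum Z ++ enum (~: Z).
have eU Z : uniq (e Z).
  rewrite cat_uniq !enum_uniq andbT /=; apply/hasPn => y.
  by rewrite !mem_enum inE.
have memE Z y : y \in e Z by rewrite mem_cat !mem_enum inE orbN.
have sizeE Z : size (e Z) = #|T| by rewrite size_cat -!cardE cardsC.
have ltE Z y : (index y (e Z) < #|T|)%N by rewrite -(sizeE Z) index_mem.
pose f y := nth y (e Y) (index y (e X)).
have f_inj : injective f.
  move=> y z; rewrite /f (set_nth_default z) ?sizeE // => /eqP.
  rewrite nth_uniq ?sizeE // => /eqP /(congr1 (nth z (e X))).
  by rewrite !nth_index.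
exists (perm f_inj); apply/eqP.
rewrite eqEcard card_imset ?cXY ?leqnn ?andbT; last exact: perm_inj.
apply/subsetP => _ /imsetP[y yX ->]; rewrite permE /f nth_cat index_cat.
have iy : (index y (enum X) < #|Y|)%N by rewrite -cXY cardE index_mem mem_enum.
by rewrite mem_enum yX -cardE iy -mem_enum mem_nth // -cardE.
Qed.

(** Permutations act transitively on the sets of size [j], so all of them are
    hit equally often; dividing [n!] by the number ['C(n, j)] of such sets gives
    the multiplicity. *)
Lemma sum_perm_imset_prefix (R : nmodType) (n j : nat) (phi : {set 'I_n} -> R) :
    (j <= n)%N ->
  \sum_(t : 'S_n) phi (t @: [set i : 'I_n | (i < j)%N]) =
  \sum_(B : {set 'I_n} | #|B| == j) phi B *+ (j`! * (n - j)`!).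
Proof.
move=> jn; set P := [set i : 'I_n | (i < j)%N].
have cP : #|P| = j.
  by rewrite cardsE -sum1_card (big_ord_narrow (F := fun=> 1%N) jn) sum1_card card_ord.
pose N (B : {set 'I_n}) := #|[set t : 'S_n | t @: P == B]|.
have NE (B : {set 'I_n}) : #|B| = j -> N B = N P.
  move=> cB; have [s sP] : exists s : 'S_n, s @: P = B.
    by apply: imset_perm_exists; rewrite cP cB.
  rewrite /N -[RHS](card_imset _ (mulIg s)); apply: eq_card => t; rewrite inE.
  apply/eqP/imsetP => [tP|[u]].
    exists (t * s^-1)%g; last by rewrite mulgKV.
    rewrite inE; apply/eqP; rewrite -[in RHS](imset_id P).
    transitivity (s^-1%g @: (t @: P)).
      by rewrite -imset_comp; apply: eq_imset => i; rewrite /= permM.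
    rewrite tP -sP -imset_comp; apply: eq_imset => i /=; exact: permK.
  rewrite inE => /eqP uP ->; rewrite -sP -[in RHS]uP -imset_comp.
  by apply: eq_imset => i; rewrite /= permM.
have partE (R' : nmodType) (psi : {set 'I_n} -> R') :
    \sum_(t : 'S_n) psi (t @: P) = \sum_(B : {set 'I_n} | #|B| == j) psi B *+ N P.
  rewrite (partition_big (fun t : 'S_n => t @: P) (fun B => #|B| == j)) /=; last first.
    by move=> t _; rewrite card_imset ?cP //; exact: perm_inj.
  apply: eq_bigr => B /eqP cB; rewrite (eq_bigr (fun=> psi B)) => [|t /eqP-> //].
  rewrite -(NE B cB) /N -sumr_const; apply: eq_bigl => t; rewrite inE //.
have NP : N P = (j`! * (n - j)`!)%N.
  have := partE _ (fun=> 1%N); rewrite sum1_card card_Sn -(bin_fact jn) => /esym.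
  under eq_bigr do rewrite natn.
  rewrite sum_nat_cond_const card_draws card_ord => /eqP.
  by rewrite eqn_pmul2l ?bin_gt0 // => /eqP.
by rewrite partE NP.
Qed.

(** The [j]-th term of [C] depends on the permutation only through the set of
    its first [j] values, so [sum_perm_imset_prefix] applies. *)
Lemma sum_C_subsets (n : nat) (k : 'I_n.+1 -> nat) :
  \sum_(t : 'S_n) C (fun i : 'I_n.+1 => k (lift_perm ord_max ord_max t i)) =
  \sum_(X : {set 'I_n.+1} | (X \subset [set~ ord_max]) && (X != set0))
    (#|X|`! * #|[set~ ord_max] :\: X|`!)%:R *
    ((-1) ^+ (\sum_(i in X) k i) *
     ('C((\sum_i k i)%N, (\sum_(i in X) k i)%N))%:Z).
Proof.
pose emb (B : {set 'I_n}) : {set 'I_n.+1} := lift ord_max @: B.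
pose phi (X : {set 'I_n.+1}) : int := (-1) ^+ (\sum_(i in X) k i) *
     ('C((\sum_i k i)%N, (\sum_(i in X) k i)%N))%:Z.
have lift_widen (i : 'I_n) : widen_ord (leqnSn n) i = lift ord_max i.
  by apply/val_inj; rewrite /= /bump leqNgt ltn_ord.
have prefixE (t : 'S_n) j : (j <= n)%N ->
    (\sum_(i < n.+1 | (i < j)%N) k (lift_perm ord_max ord_max t i) =
     \sum_(i in emb (t @: [set i : 'I_n | (i < j)%N])) k i)%N.
  move=> jn; rewrite big_mkcond big_ord_recr /= ltnNge jn /= addn0 -big_mkcond /=.
  rewrite big_imset /=; last by move=> i i' _ _; exact: lift_inj.
  rewrite big_imset /=; last by move=> i i' _ _; exact: perm_inj.
  by apply: eq_big => [i|i _]; rewrite ?inE // lift_widen lift_perm_lift.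
transitivity (\sum_(1 <= j < n.+1) \sum_(t : 'S_n)
    phi (emb (t @: [set i : 'I_n | (i < j)%N]))).
  rewrite [RHS]exchange_big /=; apply: eq_bigr => t _; rewrite /C.
  apply: eq_big_nat => j /andP[_ jn]; rewrite /phi prefixE //.
  have -> : (\sum_i k (lift_perm ord_max ord_max t i) = \sum_i k i)%N.
    by rewrite [RHS](reindex_inj (@perm_inj _ (lift_perm ord_max ord_max t))).
  by [].
have embK : {in [pred X : {set 'I_n.+1} | X \subset [set~ ord_max]],
    cancel (fun X : {set 'I_n.+1} => [set i | lift ord_max i \in X]) emb}.
  move=> X /= XK; apply/setP => i; apply/imsetP/idP => [[j]|iX].
    by rewrite inE => jX ->.
  have := subsetP XK i iX; rewrite !inE eq_sym => /unlift_some[j ij _].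
  by exists j; rewrite // inE -ij.
have embI : injective emb by apply: imset_inj; exact: lift_inj.
have emb_sub B : emb B \subset [set~ ord_max].
  by apply/subsetP => _ /imsetP[i _ ->]; rewrite !inE eq_sym neq_lift.
rewrite (reindex_onto emb (fun X => [set i | lift ord_max i \in X])) /=; last first.
  by move=> X /andP[XK _]; exact: embK.
have card_emb (B : {set 'I_n}) : #|emb B| = #|B|.
  by rewrite card_imset //; exact: lift_inj.
transitivity (\sum_(B : {set 'I_n} | B != set0)
    (#|B|`! * (n - #|B|)`!)%:R * phi (emb B)); last first.
  apply: eq_big => [B|B _].
    rewrite emb_sub /= -!card_gt0 card_emb; apply/esym/andb_idr => _.
    by apply/eqP/setP => i; rewrite inE mem_imset //; exact: lift_inj.
  rewrite card_emb cardsD (setIidPr _) ?emb_sub // cardsC1 card_ord card_emb //.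
rewrite (partition_big (fun B : {set 'I_n} => inord #|B| : 'I_n.+1)
  (fun j => 0 < j)%N) /=; last first.
  move=> B; rewrite -card_gt0 inordK // ltnS -[X in (_ <= X)%N]card_ord; exact: max_card.
rewrite big_geq_mkord /=; apply: eq_bigr => j j_gt0.
rewrite (sum_perm_imset_prefix (fun B => phi (emb B))); last by rewrite -ltnS.
have cardB (B : {set 'I_n}) : (inord #|B| == j) = (#|B| == j).
  rewrite -val_eqE /= inordK // ltnS -[X in (_ <= X)%N]card_ord; exact: max_card.
apply: eq_big => [B|B /eqP <-]; last by rewrite mulr_natl.
rewrite cardB -card_gt0 andbC; apply/esym/andb_idr => /eqP ->; exact: j_gt0.
Qed.

(** * The identity modulo p *)

Section Component.
Variables (F : fieldType) (p : nat).
Hypothesis pcharF : p \in [pchar F].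

(** The positivity condition can be dropped because a zero entry makes the
    summand [0^-1 = 0]. *)
Lemma zeta_component (n : nat) (k : 'I_n -> nat) (s : 'S_n) :
    (forall i, 0 < k i)%N ->
  \sum_(m : {ffun 'I_n -> 'I_p} | [forall i, (0 < m i)%N] &&
          [forall i : 'I_n, forall j : 'I_n, (i < j)%N ==> (m i < m j)%N])
     (\prod_(i < n) (m i)%:R ^+ k (s i))^-1 =
  \sum_(m : {ffun 'I_n -> 'I_p} | increasing m)
     \prod_i ((fcomp m s^-1%g i)%:R ^+ k i)^-1 :> F.
Proof.
move=> k_gt0; rewrite big_mkcond [RHS]big_mkcond; apply: eq_bigr => m _.
rewrite -/(increasing m); case: (increasing m); last by rewrite andbF.
rewrite andbT; have -> : \prod_i ((fcomp m s^-1%g i)%:R ^+ k i)^-1 =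
    (\prod_(i < n) (m i)%:R ^+ k (s i))^-1 :> F.
  rewrite prodfV (reindex_inj (@perm_inj _ s)); congr (_^-1).
  by apply: eq_bigr => i _; rewrite ffunE permK.
case: forallP => // /forallP; rewrite negb_forall => /existsP[i].
rewrite -eqn0Ngt => /eqP mi0.
by rewrite (bigD1 i) //= mi0 expr0n eqn0Ngt k_gt0 mul0r invr0.
Qed.

Lemma component_identity (n : nat) (k : 'I_n.+1 -> nat) :
    (forall i, 0 < k i)%N -> ((\sum_i k i).+1 < p)%N ->
  \sum_(s : 'S_n.+1)
     (n.+1%:Z + 1 - 2 * ((s^-1)%g ord_max).+1%:Z)%:~R *
     \sum_(m : {ffun 'I_n.+1 -> 'I_p} | [forall i, (0 < m i)%N] &&
          [forall i : 'I_n.+1, forall j : 'I_n.+1, (i < j)%N ==> (m i < m j)%N])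
       (\prod_(i < n.+1) (m i)%:R ^+ k (s i))^-1
  = ((-1) ^+ n.+1 * 2
       * \sum_(t : 'S_n)
           C (fun i : 'I_n.+1 => k (lift_perm ord_max ord_max t i)))%:~R
    * ratr (bernoulli (p - \sum_i k i) / (\sum_i k i)%:R) :> F.
Proof.
move=> k_gt0; set K := (\sum_i k i)%N => kp.
pose x (i : 'I_n.+1) (w : 'I_p) : F := (w%:R ^+ k i)^-1.
have prodx (X : {set 'I_n.+1}) w :
    \prod_(i in X) x i w = (w%:R ^+ (\sum_(i in X) k i))^-1.
  by rewrite prodfV prodrXr.
have sum_gt0 (X : {set 'I_n.+1}) : X != set0 -> (0 < \sum_(i in X) k i)%N.
  by case/set0Pn => i iX; rewrite (bigD1 i) //= addn_gt0 k_gt0.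
have sumK (X : {set 'I_n.+1}) : (\sum_(i in X) k i + \sum_(i in ~: X) k i)%N = K.
  rewrite /K [RHS](bigID (mem X)) /=; congr (_ + _)%N.
  by apply: eq_bigl => i; rewrite inE.
have power_sum0 (X : {set 'I_n.+1}) : X != set0 -> \sum_w \prod_(i in X) x i w = 0.
  move=> X0; under eq_bigr do rewrite prodx.
  rewrite (sum_natrXV_pchar pcharF) // sum_gt0 //=.
  apply: (@leq_ltn_trans K); last by lia.
  by rewrite -(sumK X) leq_addr.
under eq_bigr do rewrite zeta_component //.
rewrite (sum_perm_increasing ord_max
  (fun a => (n.+1%:Z + 1 - 2 * a.+1%:Z)%:~R) (fun f => \prod_i x i (f i))).
under eq_bigr => f /injectiveP f_inj do rewrite sum_sgn_rank //.
have p_gt0 : (0 < p)%N by lia.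
rewrite (sum_injective_pairs power_sum0 ord_max [ffun=> Ordinal p_gt0]); last first.
  by move=> v; rewrite /sgn_ord subrr.
rewrite sum_C_subsets card_ord rmorphM rmorphM rmorphXn rmorphN1 /= -!mulrA.
congr (_ * _); rewrite rmorph_sum /= mulr_suml mulr_sumr.
apply: eq_bigr => X /andP[XK X0].
have XC0 : ~: X != set0.
  apply/set0Pn; exists ord_max; rewrite inE; apply/negP => /(subsetP XK).
  by rewrite !inE eqxx.
under eq_bigr => u _ do under eq_bigr => v _ do rewrite !prodx.
rewrite sgn_double_sum_pchar ?sum_gt0 ?sumK //.
rewrite !rmorphM rmorphXn rmorphN1 /= rmorph_nat -!pmulrn; ring.
Qed.

End Component.

(** * Passing to the quotient *)

Definition eval_at (p : primes_t) (a : prodF) : 'F_(val p) := a p.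

Fact eval_at_zmod_morphism p : zmod_morphism (eval_at p).
Proof. by []. Qed.

Fact eval_at_monoid_morphism p : monoid_morphism (eval_at p).
Proof. by []. Qed.

HB.instance Definition _ p := GRing.isZmodMorphism.Build prodF 'F_(val p)
  (eval_at p) (eval_at_zmod_morphism p).
HB.instance Definition _ p := GRing.isMonoidMorphism.Build prodF 'F_(val p)
  (eval_at p) (eval_at_monoid_morphism p).

Theorem theorem3p5 (n : nat) (k : 'I_n.+1 -> nat)
    (k_gt0 : forall i : 'I_n.+1, (0 < k i)%N) :
  \sum_(s : 'S_n.+1)
     (n.+1%:Z + 1 - 2 * ((s^-1)%g ord_max).+1%:Z)%:~R
       * zetaA (fun i : 'I_n.+1 => k (s i))
  = ((-1) ^+ n.+1 * 2
       * \sum_(t : 'S_n)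
           C (fun i : 'I_n.+1 => k (lift_perm ord_max ord_max t i)))%:~R
    * Z (\sum_(i < n.+1) k i)%N.
Proof.
set K := (\sum_i k i)%N; rewrite /zetaA /Z.
have famM (e : int) (a : prodF) : e%:~R * fam a = fam (e%:~R * a).
  by rewrite /fam rmorphM rmorph_int.
rewrite famM; under eq_bigr do rewrite famM.
rewrite /fam -rmorph_sum; apply/famP; exists K.+1 => p Kp.
rewrite -[LHS]/(eval_at p _) -[RHS]/(eval_at p _) rmorph_sum /= rmorphM rmorph_int.
under eq_bigr do rewrite rmorphM rmorph_int.
have H := component_identity (pchar_Fp (valP p)) k_gt0 Kp. exact H.
Qed.
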